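(* Let $\lambda>0$, let $Q$ be a probability measure on $\mathbb{R}_+$ and $(H_\Delta)_{\Delta\in\mathcal{S}_{bp}}$ a family of Hamiltonians (as in the context), and let $\mathbf{G}(\lambda)$ be the associated set of Gibbs states, assumed non-empty. If there exists a disagreement coupling family at level $(\overline{\alpha},\overline{Q})$ for this Gibbs specification, where $\overline{\alpha}>0$ and $\overline{Q}$ is a probability measure on $\mathbb{R}_+$ with $\int_{\mathbb{R}_+}r^d\,\overline{Q}(dr)<\infty$ and $\overline{\alpha}<\alpha_c(d,\overline{Q})$, then there is a unique Gibbs state in $\mathbf{G}(\lambda)$.
   Context: Space. $S:=\mathbb{R}^d\times\mathbb{R}_+$ with Borel sets $\mathcal{S}$; $\mathcal{S}_{bp}$ is the collection of Borel sets of $S$ whose projection onto $\mathbb{R}^d$ is a bounded Borel set. $\Omega$ is the set of configurations $\omega\subseteq S$ with $|\omega\cap(\Lambda\times\mathbb{R}_+)|<\infty$ for every bounded $\Lambda\subseteq\mathbb{R}^d$; $\mathcal{F}$ is the $\sigma$-algebra on $\Omega$ generated by the counting variables. For $\Delta\in\mathcal{S}$, $\Omega_\Delta$ is the set of configurations contained in $\Delta$, $\omega_\Delta:=\omega\cap\Delta$, and $\mathcal{F}_\Delta$ is the $\sigma$-algebra generated by the events $\{\omega:\omega_\Delta\in E\}$, $E\in\mathcal{F}$. A point process is identified with its law, a probability measure on $\Omega$ with canonical variable $\xi$. Connectivity. $B(x,r)$ is the closed Euclidean ball of radius $r$ around $x$, and $B(X):=B(x,r)$ for $X=(x,r)\in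 S$. The Gilbert graph $\mathcal{G}(\omega)$ has vertex set $\omega$ and an edge between $X,Y\in\omega$ whenever $B(X)\cap B(Y)\ne\emptyset$. $X,Y\in S$ are connected by $\omega$ if there is a path from $X$ to $Y$ in $\mathcal{G}(\omega\cup\{X,Y\})$; $X$ is connected by $\omega$ to a configuration $\omega'$ if it is connected by $\omega$ to some $Y\in\omega'$. Poisson process and percolation. $P^{poi}_{\alpha,Q}$ is the law of the Poisson point process on $S$ with intensity measure $\alpha\,\mathcal{L}\otimes Q$ ($\mathcal{L}$ is Lebesgue measure on $\mathbb{R}^d$), and $P^{poi}_{\Delta,\alpha,Q}$ its restriction to $\Delta$. A configuration percolates if its Gilbert graph contains an infinite connected component. $\alpha_c(d,Q)\in[0,\infty]$ is the threshold intensity such that $P^{poi}_{\alpha,Q}$-almost no configuration percolates for $\alpha<\alpha_c(d,Q)$ and $P^{poi}_{\alpha,Q}$-almost every configuration percolates for $\alpha>\alpha_c(d,Q)$. Hamiltonians. For every $\Delta\in\mathcal{S}_{bp}$, $H_\Delta:\Omega_\Delta\times\Omega_{\Delta^c}\to\,]-\infty,\infty]$ is jointly measurable, $H_\Delta(\emptyset\mid\gamma)=0$, and for disjoint $\Delta_1,\Delta_2\in\mathcal{S}_{bp}$, $\omega^1\in\Omega_{\Delta_1}$, $\omega^2\in\Omega_{\Delta_2}$, $\gamma\in\Omega_{(\Delta_1\cup\Delta_2)^c}$, $$H_{\Delta_1\cup\Delta_2}(\omega^1\cup\omega^2\mid\gamma)=H_{\Delta_1}(\omega^1\mid\gamma\cup\omega^2)+H_{\Delta_2}(\omega^2\mid\gamma).$$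 Gibbs specification and Gibbs states. For $\Delta\in\mathcal{S}_{bp}$ and $\gamma\in\Omega_{\Delta^c}$, $P^{gb(\lambda)}_{\Delta,\gamma}$ is the probability measure on $(\Omega_\Delta,\mathcal{F}_\Delta)$ $$P^{gb(\lambda)}_{\Delta,\gamma}(d\omega)=\frac{e^{-H_\Delta(\omega\mid\gamma)}}{Z(\lambda,\Delta,\gamma)}P^{poi}_{\Delta,\lambda,Q}(d\omega),\qquad Z(\lambda,\Delta,\gamma)=\int e^{-H_\Delta(\omega\mid\gamma)}P^{poi}_{\Delta,\lambda,Q}(d\omega),$$ where $Z(\lambda,\Delta,\gamma)<\infty$ is understood. A point process $P$ is a Gibbs state if for every $\Delta\in\mathcal{S}_{bp}$ and for $P$-a.e. value $\gamma$ of $\xi_{\Delta^c}$, $P(\xi_\Delta\in d\omega\mid\xi_{\Delta^c}=\gamma)=P^{gb(\lambda)}_{\Delta,\gamma}(d\omega)$ (DLR equations). $\mathbf{G}(\lambda)$ is the set of Gibbs states. Disagreement coupling family at level $(\overline{\alpha},\overline{Q})$: a family of probability measures $(P_{\Delta,\gamma^1,\gamma^2})$ on $(\Omega_\Delta^3,\mathcal{F}_\Delta^{\otimes 3})$, indexed by $\Delta\in\mathcal{S}_{bp}$ and $\gamma^1,\gamma^2\in\Omega_{\Delta^c}$, measurable in the boundary conditions $(\gamma^1,\gamma^2)$, such that, with canonical variables $(\xi^1,\xi^2,\xi^3)$: (a) for $i=1,2$, $\xi^i$ has law $P^{gb(\lambda)}_{\Delta,\gamma^i}$; (b) $\xi^3$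 has law $P^{poi}_{\Delta,\overline{\alpha},\overline{Q}}$; (c) $\xi^1\cup\xi^2\subseteq\xi^3$ almost surely; (d) almost surely every $X\in\xi^1\bigtriangleup\xi^2$ (symmetric difference) is connected by $\xi^3$ to $\gamma^1\cup\gamma^2$. *)

(* Defs.v *)
From HB Require Import structures.
From mathcomp Require Import all_boot all_order all_algebra.
From mathcomp Require Import all_classical all_reals all_analysis.
From mathcomp Require Import measurable_realfun.

Set Implicit Arguments.
Unset Strict Implicit.
Unset Printing Implicit Defensive.

Import Order.TTheory GRing.Theory Num.Theory.
Import numFieldNormedType.Exports.

Local Open Scope classical_set_scope.
Local Open Scope ring_scope.

Lemma sigma_finite_product d1 d2 (T1 : measurableType d1)
    (T2 : measurableType d2) (R : realType)
    (m1 : {sigma_finite_measure set T1 -> \bar R})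
    (m2 : {sigma_finite_measure set T2 -> \bar R}) :
  sigma_finite setT (m1 \x m2)%E.
Proof.
have /sigma_finiteP[F [TF ndF Foo]] := sigma_finiteT m1.
have /sigma_finiteP[G [TG ndG Goo]] := sigma_finiteT m2.
exists (fun n => F n `*` G n).
  rewrite -setXTT TF TG predeqE => -[x y]; split.
    move=> [/= [n _ Fnx] [k _ Gky]]; exists (maxn n k) => //; split.
    - by move: x Fnx; exact/subsetPset/ndF/leq_maxl.
    - by move: y Gky; exact/subsetPset/ndG/leq_maxr.
  by move=> [n _ []/= ? ?]; split; exists n.
move=> k; have [? ?] := Foo k; have [? ?] := Goo k.
split; first exact: measurableX.
by rewrite product_measure1E// lte_mul_pinfty// ge0_fin_numE.
Qed.

Section lebesgue_vec.
Context {R : realType}.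
Local Notation vec n := (n.-tuple (measurableTypeR R)).

Definition vcons n (x : measurableTypeR R * vec n) : vec n.+1 :=
  [tuple of x.1 :: x.2].

Definition vsplit n (x : vec n.+1) : measurableTypeR R * vec n :=
  (thead x, [tuple of behead x]).

Lemma vconsK n : cancel (@vcons n) (@vsplit n).
Proof. by case=> a t; congr pair; apply/val_inj. Qed.

Lemma measurable_vcons n : measurable_fun setT (@vcons n).
Proof.
apply: (@measurable_cons _ _ _ _ fst n snd); [exact: measurable_fst|].
exact: measurable_snd.
Qed.

Lemma measurable_vsplit n : measurable_fun setT (@vsplit n).
Proof.
apply/measurable_fun_pair; last exact: measurable_behead.
exact: (@measurable_tnth _ _ n.+1 ord0).
Qed.

HB.instance Definition _ n :=
  isMeasurableFun.Build _ _ _ _ (@vcons n) (@measurable_vcons n).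

Section step.
Variables (n : nat) (mu : {sigma_finite_measure set (vec n) -> \bar R}).

Definition lebesgue_step : set (vec n.+1) -> \bar R :=
  pushforward (@lebesgue_measure R \x mu)%E (@vcons n).

Let step0 : lebesgue_step set0 = 0%E.
Proof. by rewrite /lebesgue_step /pushforward preimage_set0 measure0. Qed.

Let step_ge0 A : (0 <= lebesgue_step A)%E.
Proof. exact: measure_ge0. Qed.

Let step_sigma_additive : semi_sigma_additive lebesgue_step.
Proof. exact: measure_semi_sigma_additive. Qed.

HB.instance Definition _ := isMeasure.Build _ _ _ lebesgue_step
  step0 step_ge0 step_sigma_additive.

Let step_sigma_finite : sigma_finite setT lebesgue_step.
Proof.
have [F TF Foo] := sigma_finite_product (@lebesgue_measure R) mu.
exists (fun k => (@vsplit n) @^-1` F k).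
  by rewrite -preimage_bigcup -TF preimage_setT.
move=> k; have [mF Fk] := Foo k; split.
  by rewrite -[X in measurable X]setTI; exact: measurable_vsplit.
rewrite /lebesgue_step /pushforward -comp_preimage.
by rewrite (_ : _ \o _ = id) ?preimage_id//; apply/funext => x /=; rewrite vconsK.
Qed.

HB.instance Definition _ := Measure_isSigmaFinite.Build _ _ _ lebesgue_step
  step_sigma_finite.

End step.

(* Lebesgue measure on R^n, as the n-fold product of the one-dimensional
   Lebesgue measure. *)
Fixpoint lebesgue_vec n : {sigma_finite_measure set (vec n) -> \bar R} :=
  if n is n'.+1 then lebesgue_step (lebesgue_vec n') else \d_[tuple].

Lemma lebesgue_vec_box n (A : 'I_n -> set (measurableTypeR R)) :
  (forall i, measurable (A i)) ->
  lebesgue_vec n [set x | forall i, A i (tnth x i)] =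
  (\prod_(i < n) lebesgue_measure (A i))%E.
Proof.
elim: n A => [A _|n IH A mA].
  by rewrite big_ord0 /= diracE mem_set// => -[].
rewrite big_ord_recl -IH//= /lebesgue_step /pushforward.
rewrite -product_measure1E//; last first.
  rewrite (_ : mkset _ = \bigcap_(i in [set: 'I_n])
      ((fun x : vec n => tnth x i) @^-1` A (lift ord0 i))); last first.
    by apply/seteqP; split => x /= h i; [move=> _; exact: h|exact: (h i Logic.I)].
  apply: fin_bigcap_measurable => // i _.
  by rewrite -[X in measurable X]setTI; exact: measurable_tnth.
congr (_ _); apply/seteqP; split => -[a t] /=.
  move=> h; split; first exact: (h ord0).
  by move=> i; have := h (lift ord0 i); rewrite tnthS.
move=> [h1 h2] i; case: (unliftP ord0 i) => [j|] ->; last exact: h1.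
by rewrite tnthS; exact: h2.
Qed.

End lebesgue_vec.

Notation vec R d := (d.-tuple (measurableTypeR R)).
Notation mpoint R d := (vec R d * measurableTypeR R)%type.

Section space.
Context {R : realType} {d : nat}.

Local Notation vec := (vec R d).
Local Notation mpoint := (mpoint R d).

Definition edist (x y : vec) : R :=
  Num.sqrt (\sum_(i < d) ((tnth x i : R) - (tnth y i : R)) ^+ 2).

Definition cball (x : vec) (r : R) : set vec := [set y | edist x y <= r].

Definition bounded_vec (L : set vec) : Prop :=
  exists x r, L `<=` cball x r.

(* R^d x R_+, as a subset of R^d x R *)
Definition halfspace : set mpoint := [set X | 0 <= (X.2 : R)].

Definition Sbp (D : set mpoint) : Prop :=
  [/\ measurable D, D `<=` halfspace,
      measurable (fst @` D) & bounded_vec (fst @` D)].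

End space.

Arguments halfspace R d : clear implicits.

Record config (R : realType) (d : nat) := Config {
  points :> set (mpoint R d) ;
  points_sub : points `<=` halfspace R d ;
  points_fin : forall L, bounded_vec L -> finite_set (points `&` fst @^-1` L) }.

Section configurations.
Context {R : realType} {d : nat}.

Local Notation Omega := (config R d).
Local Notation mpoint := (mpoint R d).

Lemma empty_sub : set0 `<=` halfspace R d.
Proof. exact: sub0set. Qed.

Lemma empty_fin (L : set (vec R d)) :
  bounded_vec L -> finite_set ((set0 : set mpoint) `&` fst @^-1` L).
Proof. by rewrite set0I. Qed.

Definition cfg0 : Omega := Config empty_sub empty_fin.

Lemma union_sub (w1 w2 : Omega) : w1 `|` w2 `<=` halfspace R d.
Proof. by rewrite subUset; split; exact: points_sub. Qed.

Lemma union_fin (w1 w2 : Omega) L :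
  bounded_vec L -> finite_set ((w1 `|` w2) `&` fst @^-1` L).
Proof. by move=> bL; rewrite setIUl finite_setU; split; exact: points_fin. Qed.

Definition cfgU (w1 w2 : Omega) : Omega :=
  Config (@union_sub w1 w2) (@union_fin w1 w2).

Lemma restrict_sub (D : set mpoint) (w : Omega) : w `&` D `<=` halfspace R d.
Proof. by move=> X [/points_sub]. Qed.

Lemma restrict_fin (D : set mpoint) (w : Omega) L :
  bounded_vec L -> finite_set ((w `&` D) `&` fst @^-1` L).
Proof.
move=> bL; apply: sub_finite_set (points_fin w bL).
by move=> X [[]].
Qed.

Definition restrict (D : set mpoint) (w : Omega) : Omega :=
  Config (@restrict_sub D w) (@restrict_fin D w).

(* Omega_D; Omega_{D^c} is confined (~` D), as configurations lie in the
   half-space. *)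
Definition confined (D : set mpoint) : set Omega := [set w : Omega | w `<=` D].

Definition npoints (A : set mpoint) (w : Omega) : \bar R := counting (w `&` A).

Definition counting_sets : set (set Omega) :=
  [set E | exists (A : set mpoint) (B : set (\bar R)),
     [/\ measurable A, measurable B & E = npoints A @^-1` B]].

End configurations.

HB.instance Definition _ R d := gen_eqMixin (config R d).
HB.instance Definition _ R d := gen_choiceMixin (config R d).
HB.instance Definition _ R d := isPointed.Build (config R d) cfg0.
HB.instance Definition _ R d := @isMeasurable.Build
  (sigma_display (@counting_sets R d)) (config R d) <<s @counting_sets R d >>
  (@sigma_algebra0 _ setT (@counting_sets R d))
  (@sigma_algebraC (config R d) (@counting_sets R d))
  (@sigma_algebra_bigcup _ setT (@counting_sets R d)).

Lemma measurable_restrict (R : realType) (d : nat) (D : set (mpoint R d)) :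
  measurable D -> measurable_fun setT (restrict D).
Proof.
move=> mD; apply: (@measurability _ _ _ _ setT _ counting_sets) => //.
move=> _ [_ [A [B [mA mB ->]]] <-]; rewrite setTI.
apply: sub_sigma_algebra; exists (D `&` A), B; split => //.
  exact: measurableI.
by apply/seteqP; split => w; rewrite /npoints /= setIA.
Qed.

Section connectivity.
Context {R : realType} {d : nat}.

Definition gilbert_edge (W : set (mpoint R d)) : rel (mpoint R d) :=
  fun X Y => `[< [/\ W X, W Y & cball X.1 X.2 `&` cball Y.1 Y.2 !=set0] >].

Definition connected_by (w : config R d) (X Y : mpoint R d) : Prop :=
  exists2 p : seq (mpoint R d),
    path (gilbert_edge (w `|` [set X; Y])) X p & last X p = Y.

Definition connected_to (w : config R d) (X : mpoint R d)
    (w' : set (mpoint R d)) : Prop :=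
  exists2 Y, w' Y & connected_by w X Y.

Definition percolates (w : config R d) : Prop :=
  exists2 X, points w X & infinite_set [set Y | points w Y /\ connected_by w X Y].

End connectivity.

Section poisson.
Context {R : realType} {d : nat}.

Local Notation Omega := (config R d).
Local Notation mpoint := (mpoint R d).

Definition intensity (a : R) (Q : probability (measurableTypeR R) R) :
    set mpoint -> \bar R :=
  fun A => (a%:E * (lebesgue_vec d \x Q) A)%E.

(* numbers of points in disjoint sets of finite intensity are independent and
   Poisson distributed; the second argument of poisson_prob is a dummy *)
Definition is_poisson_process (m : set mpoint -> \bar R)
    (P : probability Omega R) : Prop :=
  forall n (A : 'I_n -> set mpoint),
    (forall i, measurable (A i)) -> (forall i, (m (A i) < +oo)%E) ->
    trivIset setT A ->
  forall k : 'I_n -> nat,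
    P [set w | forall i, npoints (A i) w = (k i)%:R%:E] =
    (\prod_(i < n) poisson_prob (fine (m (A i))) 0 [set k i])%E.

(* For d > 0, a >= 0 and Q carried by R_+ the intensity is diffuse and locally
   finite, so the Poisson process exists as a simple point process and its law
   is unique on measurable sets. *)
Definition poisson_law (a : R) (Q : probability (measurableTypeR R) R) :
    probability Omega R :=
  get (is_poisson_process (intensity a Q)).

Definition poisson_in (D : set mpoint) (a : R)
    (Q : probability (measurableTypeR R) R) : set Omega -> \bar R :=
  pushforward (poisson_law a Q) (restrict D).

(* The largest t such that almost no configuration percolates at any intensity
   below t. By monotonicity in the intensity and the 0-1 law, almost every
   configuration percolates at any intensity above it. *)
Definition alpha_c (Q : probability (measurableTypeR R) R) : \bar R :=
  ereal_sup [set t : \bar R | (0 <= t)%E /\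
    forall a : R, 0 <= a -> (a%:E < t)%E ->
      {ae poisson_law a Q, forall w, ~ percolates w}].

End poisson.
Arguments alpha_c {R} d Q.

Section gibbs.
Context {R : realType} {d : nat}.

Local Notation Omega := (config R d).
Local Notation mpoint := (mpoint R d).

(* H D w g stands for H_D(w | g); only its values for D in S_bp, w in Omega_D
   and g in Omega_{D^c} are meaningful. *)
Record hamiltonian (H : set mpoint -> Omega -> Omega -> \bar R) : Prop := {
  ham_measurable : forall D, Sbp D ->
    measurable_fun (confined D `*` confined (~` D))
      (fun p : (Omega * Omega)%type => H D p.1 p.2) ;
  ham_gtNy : forall D w g, Sbp D -> confined D w -> confined (~` D) g ->
    (-oo < H D w g)%E ;
  ham_empty : forall D g, Sbp D -> confined (~` D) g -> H D cfg0 g = 0%E ;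
  ham_union : forall D1 D2 w1 w2 g, Sbp D1 -> Sbp D2 -> D1 `&` D2 = set0 ->
    confined D1 w1 -> confined D2 w2 -> confined (~` (D1 `|` D2)) g ->
    H (D1 `|` D2) (cfgU w1 w2) g = (H D1 w1 (cfgU g w2) + H D2 w2 g)%E }.

Variables (H : set mpoint -> Omega -> Omega -> \bar R).
Variables (lambda : R) (Q : probability (measurableTypeR R) R).

Definition partition_function (D : set mpoint) (g : Omega) : \bar R :=
  (\int[poisson_in D lambda Q]_(w in confined D) expeR (- H D w g))%E.

(* Probability measures on Omega_D are seen as probability measures on Omega
   carried by Omega_D. *)
Definition gibbs_in (D : set mpoint) (g : Omega) : set Omega -> \bar R :=
  fun E => ((fine (partition_function D g))^-1%:E *
    \int[poisson_in D lambda Q]_(w in E `&` confined D) expeR (- H D w g))%E.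

(* K is a version of the conditional law of X given Y. *)
Definition conditional_law d0 d1 d2 (T : measurableType d0)
    (T1 : measurableType d1) (T2 : measurableType d2) (P : probability T R)
    (X : T -> T1) (Y : T -> T2) (K : T2 -> set T1 -> \bar R) : Prop :=
  forall A, measurable A ->
    measurable_fun setT (fun t => K (Y t) A) /\
    forall B, measurable B ->
      P (X @^-1` A `&` Y @^-1` B) = (\int[P]_(t in Y @^-1` B) K (Y t) A)%E.

Definition gibbs_state (P : probability Omega R) : Prop :=
  forall D, Sbp D ->
    conditional_law P (restrict D) (restrict (~` D)) (gibbs_in D).

Definition disagreement_coupling (a' : R)
    (Q' : probability (measurableTypeR R) R)
    (P : set mpoint -> Omega -> Omega ->
         probability (Omega * Omega * Omega)%type R) : Prop :=
  forall D, Sbp D ->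
    (forall E, measurable E ->
       measurable_fun (confined (~` D) `*` confined (~` D))
         (fun g : (Omega * Omega)%type => P D g.1 g.2 E)) /\
    forall g1 g2, confined (~` D) g1 -> confined (~` D) g2 ->
      [/\ forall E, measurable E ->
            P D g1 g2 [set x | E x.1.1] = gibbs_in D g1 E,
          forall E, measurable E ->
            P D g1 g2 [set x | E x.1.2] = gibbs_in D g2 E,
          forall E, measurable E ->
            P D g1 g2 [set x | E x.2] = poisson_in D a' Q' E,
          {ae P D g1 g2, forall x,
            points x.1.1 `|` points x.1.2 `<=` points x.2} &
          {ae P D g1 g2, forall x,
            forall X, (points x.1.1 `+` points x.1.2) X ->
              connected_to x.2 X (g1 `|` g2)}].

End gibbs.

(* Main.v *)
From Pilot Require Import Defs.
From HB Require Import structures.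
From mathcomp Require Import all_boot all_order all_algebra.
From mathcomp Require Import all_classical all_reals all_analysis.
From mathcomp Require Import measurable_realfun.
From mathcomp Require Import ring lra.
From mathcomp Require finmap.

Import Order.TTheory GRing.Theory Num.Theory.
Import numFieldNormedType.Exports.

(* Let P be a Gibbs state, E an event depending on a bounded window only and D
   a large cylinder. By the DLR equations P E is the mean of the Gibbs kernels
   on D, and each kernel is compared with the kernel with empty boundary
   condition through the disagreement coupling. A disagreement in the window
   forces the Poisson cluster of the window either to leave a ball of radius n,
   which is unlikely for n large as there is no percolation, or to meet a ball
   of the boundary condition that is centred outside D and touches that ball.
   The latter is unlikely for D large: the coupling also shows that P is
   dominated by the Poisson process, whose expected number of balls touching a
   bounded region is finite by the moment condition. Hence P E is determined by
   the kernels with empty boundary condition. *)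

Set Implicit Arguments.
Unset Strict Implicit.
Unset Printing Implicit Defensive.

Local Open Scope classical_set_scope.
Local Open Scope ring_scope.

(* all_analysis shadows these two names *)
Local Notation edist := Pilot.Defs.edist.
Local Notation restrict := Pilot.Defs.restrict.

(** * Euclidean distance and intersection of balls *)

Section geometry.
Context {R : realType} {d : nat}.
Implicit Types (x y z : vec R d) (r s : R).

Lemma l2_triangle (a b : 'I_d -> R) :
  Num.sqrt (\sum_i (a i + b i) ^+ 2) <=
  Num.sqrt (\sum_i a i ^+ 2) + Num.sqrt (\sum_i b i ^+ 2).
Proof.
set A := \sum_i a i ^+ 2; set B := \sum_i b i ^+ 2.
have A0 : 0 <= A by apply: sumr_ge0 => i _; exact: sqr_ge0.
have B0 : 0 <= B by apply: sumr_ge0 => i _; exact: sqr_ge0.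
have sA := sqr_sqrtr A0; have sB := sqr_sqrtr B0.
set p := Num.sqrt A in sA *; set q := Num.sqrt B in sB *.
have p0 : 0 <= p by exact: sqrtr_ge0.
have q0 : 0 <= q by exact: sqrtr_ge0.
have cs : \sum_i a i * b i <= p * q.
  have null (c e : 'I_d -> R) : Num.sqrt (\sum_i c i ^+ 2) = 0 ->
      \sum_i c i * e i = 0.
    move/eqP; rewrite sqrtr_eq0 => c0.
    have /eqP : \sum_i c i ^+ 2 == 0.
      by rewrite eq_le c0/= sumr_ge0// => i _; exact: sqr_ge0.
    move/psumr_eq0P => c0'; apply: big1 => i _.
    have /eqP := c0' (fun i _ => sqr_ge0 (c i)) i isT.
    by rewrite sqrf_eq0 => /eqP ->; rewrite mul0r.
  have [p_0|p_n0] := eqVneq p 0; first by rewrite null// p_0 mul0r.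
  have [q_0|q_n0] := eqVneq q 0.
    by under eq_bigr do rewrite mulrC; rewrite null// q_0 mulr0.
  have pq : 0 < p * q by rewrite mulr_gt0// lt0r ?p_n0 ?q_n0.
  (* After multiplication by 2pq, Cauchy-Schwarz holds term by term: it is the sum over i of the
     expanded squares of [q * a i - p * b i]. The factor must be positive, which is why p = 0 and q
     = 0 are treated apart. *)
  rewrite -(ler_pM2l pq) -(ler_pM2l (ltr0n _ 2)).
  have -> : 2%:R * (p * q * (p * q)) = q ^+ 2 * A + p ^+ 2 * B.
    by rewrite sA sB -sA -sB; ring.
  rewrite !mulr_sumr -big_split/=; apply: ler_sum => i _.
  by have := sqr_ge0 (q * a i - p * b i); nra.
rewrite -[leRHS]ger0_norm ?addr_ge0// -sqrtr_sqr ler_wsqrtr//.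
have -> : \sum_i (a i + b i) ^+ 2 = A + B + 2 * \sum_i a i * b i.
  by rewrite mulr_sumr -!big_split/=; apply: eq_bigr => i _; ring.
by rewrite -sA -sB; nra.
Qed.

Lemma edist_triangle x y z : edist x z <= edist x y + edist y z.
Proof.
rewrite /edist; apply: le_trans (l2_triangle _ _).
by apply: ler_wsqrtr; apply: ler_sum => i _; rewrite addrA subrK.
Qed.

Lemma edistC x y : edist x y = edist y x.
Proof. by congr Num.sqrt; apply: eq_bigr => i _; rewrite -sqrrN opprB. Qed.

Lemma edistxx x : edist x x = 0.
Proof.
rewrite /edist big1 ?sqrtr0// => i _.
by rewrite subrr expr0n.
Qed.

Lemma coord_le_edist x y i : `|(tnth x i : R) - tnth y i| <= edist x y.
Proof.
rewrite -sqrtr_sqr ler_wsqrtr// (bigD1 i)//= lerDl.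
by apply: sumr_ge0 => j _; exact: sqr_ge0.
Qed.

(** Turns the edge relation of the Gilbert graph into an inequality between measurable functions.
    For the converse, the common point divides the segment from x to y in the ratio r : s. *)
Lemma cballs_meet x y r s : 0 <= r -> 0 <= s ->
  cball x r `&` cball y s !=set0 <-> edist x y <= r + s.
Proof.
move=> r0 s0; split=> [[z [/= xz yz]]|xy].
  rewrite (le_trans (edist_triangle x z y))// lerD//.
  by rewrite edistC.
(* For r + s = 0 the ratio is undefined, but the centres are at distance 0 and x itself is a common
   point. *)
have [rs0|rs] := eqVneq (r + s) 0.
  exists x; split; rewrite /cball/= ?edistxx// edistC (le_trans xy)// rs0//.
have {rs} rs : 0 < r + s by rewrite lt0r rs addr_ge0.
pose c := r / (r + s).
pose z : vec R d := [tuple (tnth x i + c * (tnth y i - tnth x i) : R) | i < d].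
have zscale (t : R) w (w' := edist x y) :
    (forall i, ((tnth w i : R) - tnth z i) ^+ 2 =
       t ^+ 2 * ((tnth x i : R) - tnth y i) ^+ 2) -> 0 <= t ->
    edist w z = t * edist x y.
  move=> wz t0; rewrite /edist (eq_bigr _ (fun i _ => wz i)) -mulr_sumr.
  by rewrite sqrtrM ?sqr_ge0// sqrtr_sqr ger0_norm.
have c0 : 0 <= c by rewrite divr_ge0// ltW.
have c1 : 1 - c = s / (r + s) by rewrite /c; field; rewrite gt_eqF.
have c10 : 0 <= 1 - c by rewrite c1 divr_ge0// ltW.
exists z; split; rewrite /cball/=.
- rewrite (zscale c)// => [|i]; last by rewrite tnth_mktuple; ring.
  by rewrite (le_trans (ler_wpM2l c0 xy))// /c divfK// gt_eqF.
- rewrite (zscale (1 - c))// => [|i]; last by rewrite tnth_mktuple; ring.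
  by rewrite (le_trans (ler_wpM2l c10 xy))// c1 divfK// gt_eqF.
Qed.

Definition vzero : vec R d := [tuple (0 : R) | _ < d].

Definition vnorm x : R := edist x vzero.

Lemma bounded_cball0 r : bounded_vec (cball vzero r).
Proof. by exists vzero, r. Qed.

Lemma vnorm_le x y : vnorm x <= edist x y + vnorm y.
Proof. exact: edist_triangle. Qed.

Lemma tnth_vnorm x i : `|tnth x i : R| <= vnorm x.
Proof.
by have := coord_le_edist x vzero i; rewrite tnth_mktuple subr0.
Qed.

Lemma measurable_edist d0 (T : measurableType d0) (f g : T -> vec R d) :
  measurable_fun setT f -> measurable_fun setT g ->
  measurable_fun setT (fun t => edist (f t) (g t)).
Proof.
move=> mf mg; rewrite /edist.
apply: (@measurableT_comp _ _ _ _ _ _ (@Num.sqrt R)).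
  by apply: continuous_measurable_fun; exact: sqrt_continuous.
apply: measurable_sum => i; apply: measurable_funX; apply: measurable_funB.
  exact: (measurableT_comp (measurable_tnth i) mf).
exact: (measurableT_comp (measurable_tnth i) mg).
Qed.

Lemma measurable_vnorm : measurable_fun setT vnorm.
Proof. exact: measurable_edist. Qed.

Lemma measurable_cball0 r : measurable (cball vzero r).
Proof.
rewrite -[X in measurable X]setTI.
have -> : cball vzero r = (edist vzero) @^-1` `]-oo, r].
  by apply/seteqP; split => x; rewrite /cball/= in_itv.
exact: measurable_edist.
Qed.

End geometry.

(** * Cylinders, counting measures, and measurability of the existence of a point *)

Section configurations.
Context {R : realType} {d : nat}.
Local Notation Omega := (config R d).
Local Notation mpoint := (mpoint R d).
Implicit Types (w : Omega) (A : set mpoint) (X : mpoint).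

Lemma measurable_vec1 (x : vec R d) : measurable [set x].
Proof.
have -> : [set x] = \bigcap_(i in [set: 'I_d])
    ((fun y : vec R d => tnth y i) @^-1` [set tnth x i]).
  apply/seteqP; split=> [y -> i //|y yx] /=.
  by apply: eq_from_tnth => i; exact: (yx i Logic.I).
apply: fin_bigcap_measurable => // i _.
rewrite -[X in measurable X]setTI; apply: measurable_tnth => //.
Qed.

Lemma measurable_mpoint1 X : measurable [set X].
Proof.
have -> : [set X] = [set X.1] `*` [set X.2].
  by apply/seteqP; split=> [_ ->//|[x r] [/= -> ->]]; case: X.
by apply: measurableX; [exact: measurable_vec1|exact: (@measurable_set1 R)].
Qed.

(** These windows form a countable increasing exhaustion of the half-space by members of [Sbp]; all
    limits over windows are taken along them. *)
Definition cylinder (k : nat) : set mpoint :=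
  halfspace R d `&` fst @^-1` (cball vzero k%:R).

Lemma measurable_halfspace : measurable (halfspace R d).
Proof.
rewrite -[X in measurable X]setTI.
have -> : halfspace R d = snd @^-1` `[0, +oo[.
  by apply/seteqP; split => X /=; rewrite /halfspace/= in_itv/= andbT.
exact: measurable_snd.
Qed.

Lemma measurable_cylinder k : measurable (cylinder k).
Proof.
apply: measurableI; first exact: measurable_halfspace.
rewrite -[X in measurable X]setTI; apply: measurable_fst => //.
exact: measurable_cball0.
Qed.

Lemma cylinder_mono k l : (k <= l)%N -> cylinder k `<=` cylinder l.
Proof.
by move=> kl X [X0 Xk]; split=> //; rewrite /cball/= (le_trans Xk)// ler_nat.
Qed.

Lemma bigcup_cylinder : \bigcup_k cylinder k = halfspace R d.
Proof.
apply/seteqP; split=> [X [k _ []]//|X X0].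
have [n nX] : exists n : nat, edist vzero X.1 <= n%:R.
  exists (Num.truncn (edist vzero X.1)).+1.
  by rewrite ltW// truncnS_gt.
by exists n.
Qed.

Lemma Sbp_cylinder k : Sbp (cylinder k).
Proof.
have fstk : fst @` cylinder k = cball vzero k%:R.
  apply/seteqP; split=> [_ [X [_ ?] <-]//|x xk].
  by exists (x, 0) => //; split => //; rewrite /halfspace/=.
split; rewrite ?fstk.
- exact: measurable_cylinder.
- by move=> X [].
- exact: measurable_cball0.
- exact: bounded_cball0.
Qed.

Lemma finite_cylinder w k : finite_set (w `&` cylinder k).
Proof.
apply: sub_finite_set (points_fin w (bounded_cball0 k%:R)).
by move=> X [wX []].
Qed.

Lemma points_cylinder w : points w = \bigcup_k (w `&` cylinder k).
Proof.
rewrite -setI_bigcupr bigcup_cylinder setIidl//.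
exact: points_sub.
Qed.

Lemma measurable_points w : measurable (points w).
Proof.
rewrite points_cylinder; apply: bigcup_measurable => k _.
apply: countable_measurable; first exact: measurable_mpoint1.
exact/finite_set_countable/finite_cylinder.
Qed.

(** Counts seen as a genuine measure in the set argument, so that continuity from below and the
    theory of kernels apply to them. *)
Definition points_measure w : {measure set mpoint -> \bar R} :=
  mrestr counting (measurable_points w).

Lemma points_measureE w A : points_measure w A = npoints A w.
Proof. by rewrite /points_measure /mrestr/= /mrestr setIC. Qed.

Lemma npoints_eq0 A w : npoints A w = 0%E <-> w `&` A = set0.
Proof.
rewrite /npoints /counting; split=> [|->]; last first.
  by rewrite asboolT ?fset_set0//.
case: asboolP => // finA [] /eqP; rewrite pnatr_eq0 finmap.cardfs_eq0 => /eqP.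
by move/fset_set_set0; exact.
Qed.

Lemma npoints_neq0 A w : npoints A w != 0%E <-> exists2 X, points w X & A X.
Proof.
split=> [/eqP n0|[X wX AX]].
  have /eqP/set0P[X [wX AX]] : w `&` A <> set0 by move/npoints_eq0.
  by exists X.
apply/eqP => /npoints_eq0; apply/eqP/set0P.
by exists X.
Qed.

Lemma measurable_npoints A : measurable A -> measurable_fun setT (@npoints R d A).
Proof.
move=> mA _ B mB; rewrite setTI; apply: sub_sigma_algebra.
by exists A, B.
Qed.

Definition hits A : set Omega := [set w | exists2 X, points w X & A X].

Lemma hitsE A : hits A = npoints A @^-1` [set~ 0%E].
Proof.
by apply/seteqP; split=> w; [move/npoints_neq0/eqP|move/eqP/npoints_neq0].
Qed.

Lemma measurable_hits A : measurable A -> measurable (hits A).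
Proof.
move=> mA; rewrite hitsE -[X in measurable X]setTI.
by apply: measurable_npoints => //; exact: measurableC.
Qed.

Section exists_point.
Context d0 (T : measurableType d0) (f : T -> Omega).
Hypothesis mf : measurable_fun setT f.

Let K t : {measure set mpoint -> \bar R} := points_measure (f t).

Let mK (U : set mpoint) : measurable U -> measurable_fun setT (K ^~ U).
Proof.
move=> mU; under eq_fun do rewrite /K points_measureE.
exact: measurableT_comp (measurable_npoints mU) mf.
Qed.

HB.instance Definition _ := isKernel.Build _ _ _ _ _ K mK.

(** A projection of a measurable set need not be measurable. Here the counting measure of [f t] is a
    kernel in t, and a point X with [M (t, X)] exists exactly when this measure charges the section
    of M at t within some cylinder. *)
Lemma measurable_exists_point (M : set (T * mpoint)) : measurable M ->
  measurable [set t | exists2 X, points (f t) X & M (t, X)].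
Proof.
move=> mM.
pose phi k t := mrestr (K t) (measurable_cylinder k) (xsection M t).
have mphi k : measurable_fun setT (phi k).
  have [|_ //] := @measurable_prod_subset_xsection_kernel _ _ _ _ R
    K _ (measurable_cylinder k) _ M mM.
  (* The kernel lemma asks for a strict finite bound on the mass in the cylinder, hence the added
     1. *)
  move=> t; exists ((fine (npoints (cylinder k) (f t))) + 1) => U mU.
  have fin : npoints (cylinder k) (f t) \is a fin_num.
    by rewrite /npoints /counting asboolT//; exact: finite_cylinder.
  rewrite EFinD fineK//; apply: (@le_lt_trans _ _ (npoints (cylinder k) (f t))).
    rewrite -points_measureE; apply: (@le_measure _ _ _ (points_measure (f t))).
    - by rewrite inE; apply: measurableI => //; exact: measurable_cylinder.
    - by rewrite inE; exact: measurable_cylinder.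
    - exact: subIsetr.
  by rewrite lteDl// lte01.
have -> : [set t | exists2 X, points (f t) X & M (t, X)] =
    \bigcup_k (phi k @^-1` [set~ 0%E]).
  apply/seteqP; split=> [t [X fX MX]|t [k _]] /=.
    have := fX; rewrite points_cylinder => -[k _ [_ Xk]].
    exists k => //=; rewrite /phi /mrestr [K _ _]points_measureE; apply/eqP.
    by apply/npoints_neq0; exists X => //; split=> //; rewrite /xsection/= inE.
  rewrite /phi /mrestr [K _ _]points_measureE => /eqP /npoints_neq0[X fX [+ _]].
  by rewrite /xsection/= inE => MX; exists X.
apply: bigcup_measurable => k _.
rewrite -[X in measurable X]setTI; apply: mphi => //.
exact: measurableC.
Qed.

End exists_point.

End configurations.

(** * The cluster of a window, its escape from large balls, and percolation *)

Section percolation.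
Context {R : realType} {d : nat}.
Local Notation Omega := (config R d).
Local Notation mpoint := (mpoint R d).
Implicit Types (w : Omega) (L : set mpoint) (X Y Z : mpoint).

(* The endpoint is not required to belong to the configuration. *)
Fixpoint reach L (j : nat) : set (Omega * mpoint) :=
  if j is i.+1 then
    [set p | exists2 Y, points p.1 Y &
      reach L i (p.1, Y) /\ edist Y.1 p.2.1 <= (Y.2 : R) + p.2.2]
  else [set p | L p.2].

Lemma measurable_reach L j : measurable L -> measurable (reach L j).
Proof.
move=> mL; elim: j => [|j IH] /=.
  by rewrite -[X in measurable X]setTI; apply: measurable_snd.
(* The parameter is the pair of the configuration and the endpoint; the point sought is the last but
   one of the chain. *)
apply: (@measurable_exists_point R d _ (Omega * mpoint)%type fst measurable_fst
  [set q | reach L j (q.1.1, q.2) /\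
           edist q.2.1 q.1.2.1 <= (q.2.2 : R) + q.1.2.2]).
have m12 : measurable_fun setT (fun q : Omega * mpoint * mpoint => q.1.2).
  exact: measurableT_comp measurable_snd measurable_fst.
apply: measurableI.
  have : measurable_fun setT
      (fun q : Omega * mpoint * mpoint => (q.1.1, q.2)).
    apply/measurable_fun_pair; last exact: measurable_snd.
    exact: measurableT_comp measurable_fst measurable_fst.
  by move=> /(_ measurableT _ IH); rewrite setTI.
rewrite -[X in measurable X]setTI; apply: measurable_fun_le => //.
  apply: measurable_edist.
    exact: measurableT_comp measurable_fst measurable_snd.
  exact: measurableT_comp measurable_fst m12.
apply: measurable_funD.
  exact: measurableT_comp measurable_snd measurable_snd.
exact: measurableT_comp measurable_snd m12.
Qed.

(** Some ball of the cluster of L is not confined to B(0, n). Measuring by the extent of the ball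
    instead of its centre lets a cluster that touches a remote boundary ball count as escaping. *)
Definition escape L (n : nat) : set Omega :=
  [set w | exists2 X, points w X &
    (exists j, reach L j (w, X)) /\ n%:R < vnorm X.1 + X.2].

Lemma measurable_escape L n : measurable L -> measurable (escape L n).
Proof.
move=> mL.
apply: (@measurable_exists_point R d _ Omega id (@measurable_id _ _ setT)
  ([set q | exists j, reach L j q] `&`
   [set q | n%:R < vnorm q.2.1 + q.2.2])).
apply: measurableI.
  suff <- : \bigcup_j reach L j = [set q | exists j, reach L j q].
    by apply: bigcup_measurable => j _; exact: measurable_reach.
  by apply/seteqP; split=> q; [move=> [j _]; exists j|move=> [j]; exists j].
rewrite -[X in measurable X]setCK; apply: measurableC.
suff -> : ~` [set q : Omega * mpoint | n%:R < vnorm q.2.1 + q.2.2] =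
    setT `&` [set q : Omega * mpoint | vnorm q.2.1 + q.2.2 <= n%:R].
  apply: measurable_fun_le => //; apply: measurable_funD.
    apply: measurableT_comp measurable_vnorm _.
    exact: measurableT_comp measurable_fst measurable_snd.
  exact: measurableT_comp measurable_snd measurable_snd.
by rewrite setTI; apply/seteqP; split=> q /=; rewrite leNgt => /negP.
Qed.

Lemma reach_mono L j w w' X : points w `<=` points w' ->
  reach L j (w, X) -> reach L j (w', X).
Proof.
move=> ww'; elim: j X => [//|j IH] X /= [Y wY [/IH rY YX]].
by exists Y => //; exact: ww'.
Qed.

Lemma escape_mono L n w w' : points w `<=` points w' ->
  escape L n w -> escape L n w'.
Proof.
move=> ww' [X wX [[j rX] nX]]; exists X; first exact: ww'.
by split=> //; exists j; exact: reach_mono rX.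
Qed.

Lemma escape_nonincreasing L : nonincreasing_seq (escape L).
Proof.
move=> m n mn; apply/subsetPset => w [X wX [rX nX]]; exists X => //; split=> //.
by rewrite (le_lt_trans _ nX)// ler_nat.
Qed.

Lemma gilbert_edge_mono (W W' : set mpoint) X Y : W `<=` W' ->
  gilbert_edge W X Y -> gilbert_edge W' X Y.
Proof.
move=> WW' /asboolP[WX WY XY]; apply/asboolP.
by split=> //; exact: WW'.
Qed.

Lemma gilbert_edgeE w X Y : points w X -> points w Y ->
  gilbert_edge w X Y <-> edist X.1 Y.1 <= (X.2 : R) + Y.2.
Proof.
move=> wX wY; have X0 := points_sub wX; have Y0 := points_sub wY.
rewrite -(cballs_meet _ _ X0 Y0).
by split=> [/asboolP[]//|XY]; apply/asboolP.
Qed.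

Lemma reach_connected L j w X : reach L j (w, X) -> points w X ->
  exists X0, [/\ points w X0, L X0 & connected_by w X0 X].
Proof.
(* The graph in [connected_by] contains its endpoints and so would change along the induction; the
   path is therefore built in the Gilbert graph of w alone. *)
suff rp : reach L j (w, X) -> points w X -> exists X0 p,
    [/\ points w X0, L X0, path (gilbert_edge w) X0 p & last X0 p = X].
  move=> rX wX; have [X0 [p [wX0 LX0 pX <-]]] := rp rX wX.
  exists X0; split=> //; exists p => //.
  by apply: sub_path pX => Y Z; apply: gilbert_edge_mono => U; left.
elim: j X => [|j IH] X /= => [LX wX|[Y wY [rY YX]] wX].
  by exists X, [::].
have [X0 [p [wX0 LX0 pY lY]]] := IH Y rY wY.
exists X0, (rcons p X); rewrite last_rcons rcons_path pY lY; split=> //=.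
exact/gilbert_edgeE.
Qed.

Lemma bounded_on_finite (T : choiceType) (C : set T) (g : T -> R) :
  finite_set C -> exists n : nat, forall t, C t -> g t <= n%:R.
Proof.
move=> /finite_seqP[s ->]; elim: s => [|t s [n IH]]; first by exists 0%N.
exists (maxn n (Num.truncn (g t)).+1) => u /=; rewrite in_cons => /orP[/eqP ->|su].
  by rewrite (le_trans (ltW (truncnS_gt _)))// ler_nat leq_maxr.
by rewrite (le_trans (IH u su))// ler_nat leq_maxl.
Qed.

(** Without percolation, the finitely many points of the cylinder have finite clusters. The extent
    of the balls is then bounded on their union, which contradicts escape for large n. *)
Lemma escape_percolates k w :
  (\bigcap_n escape (cylinder k) n) w -> percolates w.
Proof.
move=> we; apply: contrapT => np.
pose C := \bigcup_(X in points w `&` cylinder k)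
  [set Y | points w Y /\ connected_by w X Y].
have finC : finite_set C.
  apply: bigcup_finite; first exact: finite_cylinder.
  by move=> X [wX _]; apply: contrapT => inf; apply: np; exists X.
have [n nC] := bounded_on_finite (fun X => vnorm X.1 + X.2) finC.
have [X wX [[j rX]]] := we n Logic.I.
have [X0 [wX0 kX0 cX]] := reach_connected rX wX.
by rewrite ltNge nC//; exists X0.
Qed.

Lemma escape_cvg0 k (mu : probability Omega R) :
  {ae mu, forall w, ~ percolates w} ->
  (mu \o escape (cylinder k)) @ \oo --> 0%E.
Proof.
move=> np; have mL := @measurable_cylinder R d k.
have mcap : measurable (\bigcap_n escape (cylinder k) n).
  by apply: bigcapT_measurable => n; exact: measurable_escape.
(* The limit event is measurable and contained in a negligible set, so measurability of percolation
   itself is never invoked. *)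
have <- : mu (\bigcap_n escape (cylinder k) n) = 0%E.
  apply: measure_negligible => //; apply: negligibleS np => w /=.
  by move=> /escape_percolates pw; exact.
apply: nonincreasing_cvg_mu => //.
- by rewrite (le_lt_trans (probability_le1 _ _)) ?ltry//; exact: measurable_escape.
- by move=> n; exact: measurable_escape.
- exact: escape_nonincreasing.
Qed.

(** By hypothesis B(Y) misses B(0, n). Along the path every vertex in w is reached from L. Either Y
    is itself reached, or the last vertex before it has a ball meeting B(Y), which by the triangle
    inequality sticks out of B(0, n). *)
Lemma connected_escape L n w X Y : points w X -> L X -> 0 <= (Y.2 : R) ->
  n%:R + Y.2 < vnorm Y.1 -> connected_by w X Y -> escape L n w.
Proof.
move=> wX LX Y0 nY [p].
have rX : exists j, reach L j (w, X) by exists 0%N.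
suff H Z : points w Z -> (exists j, reach L j (w, Z)) ->
  path (gilbert_edge (points w `|` [set X; Y])) Z p -> last Z p = Y -> escape L n w.
  exact: H.
elim: p Z => [|Z' p IH] Z wZ rZ /=.
  move=> _ ZY; exists Z => //; split=> //; rewrite ZY; lra.
case/andP => /asboolP[_ wZ' ZZ'] pZ' lZ'.
(* Of the two vertices adjoined to the graph, X belongs to w already. *)
have Z'cases : points w Z' \/ Z' = Y.
  by move: wZ' => /= -[|[->|->]]; auto.
have [wZ'1|Z'Y] := Z'cases.
  apply: IH pZ' lZ' => //; have [j rj] := rZ; exists j.+1; exists Z => //.
  by split=> //; apply/(gilbert_edgeE wZ wZ'1); apply/asboolP.
exists Z => //; split=> //; rewrite Z'Y in ZZ'.
have := (cballs_meet _ _ (points_sub wZ) Y0).1 ZZ'.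
have := vnorm_le Y.1 Z.1; rewrite edistC; lra.
Qed.

End percolation.

(** * Intensity of the balls touching a bounded region *)

Section poisson_bounds.
Context {R : realType} {d : nat}.
Local Notation Omega := (config R d).
Local Notation mpoint := (mpoint R d).

(* The balls centred in B(0, n + r), with r their own radius, are those that
   meet B(0, n). *)
Definition touching (n : nat) : set mpoint :=
  halfspace R d `&` [set Y | vnorm Y.1 <= n%:R + Y.2].

Definition far_touching (n m : nat) : set mpoint :=
  touching n `\` cylinder m.

Lemma measurable_touching n : measurable (touching n).
Proof.
apply: measurableI; first exact: measurable_halfspace.
rewrite -[X in measurable X]setTI; apply: measurable_fun_le => //.
  exact: measurableT_comp measurable_vnorm measurable_fst.
by apply: measurable_funD => //; exact: measurable_snd.
Qed.

Lemma measurable_far_touching n m : measurable (far_touching n m).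
Proof.
by apply: measurableD; [exact: measurable_touching|exact: measurable_cylinder].
Qed.

Lemma lebesgue_vec_cball0 (r : R) : 0 <= r ->
  (lebesgue_vec d [set x : vec R d | (vnorm x <= r)%R] <= ((2 * r) ^+ d)%:E)%E.
Proof.
move=> r0.
pose B : 'I_d -> set (measurableTypeR R) := fun _ => `[- r, r]%classic.
have mB i : measurable (B i) by exact: measurable_itv.
have mbox : measurable [set x : vec R d | forall i, B i (tnth x i)].
  have -> : [set x : vec R d | forall i, B i (tnth x i)] =
      \bigcap_(i in [set: 'I_d]) ((fun x : vec R d => tnth x i) @^-1` B i).
    by apply/seteqP; split=> x /= h i; [move=> _; exact: h|exact: (h i Logic.I)].
  apply: fin_bigcap_measurable => // i _.
  by rewrite -[X in measurable X]setTI; apply: measurable_tnth.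
have mball : measurable [set x : vec R d | vnorm x <= r].
  rewrite -[X in measurable X]setTI; apply: measurable_fun_le => //.
  exact: measurable_vnorm.
apply: (@le_trans _ _ (lebesgue_vec d [set x | forall i, B i (tnth x i)])).
  apply: le_measure; rewrite ?inE// => x xr i.
  by rewrite /B/= in_itv/= -ler_norml (le_trans (tnth_vnorm x i)).
rewrite lebesgue_vec_box// /B.
under eq_bigr => i _.
  (* For r = 0 the length formula takes its default value 0, which still equals 2r. *)
  rewrite lebesgue_measure_itv/= lte_fin.
  rewrite (_ : (if _ then _ else _) = (2 * r)%:E); last first.
    case: ifPn => [_|]; last first.
      by rewrite -leNgt => rr; congr EFin; lra.
    by rewrite -EFinD; congr EFin; ring.
  over.
by rewrite prodEFin prodr_const card_ord.
Qed.

(** The section at radius r is a ball of radius n + r, whose volume is at most (2(n + r))^d. Since n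
    + r is at most twice the larger of n and r, this is at most 4^d (n^d + r^d), which is integrable
    by the moment condition. *)
Lemma touching_fin (Q : probability (measurableTypeR R) R) n :
  (\int[Q]_(r in `[0%R, +oo[) ((r : R) ^+ d)%:E < +oo)%E ->
  ((lebesgue_vec d \x Q) (touching n) < +oo)%E.
Proof.
move=> Qd; have mt := measurable_touching n.
have mD : measurable (`[0%R, +oo[%classic : set (measurableTypeR R)).
  exact: measurable_itv.
(* The order of integration is exchanged so that the inner measure is Lebesgue measure at fixed
   radius. *)
have -> : (lebesgue_vec d \x Q)%E (touching n) =
    (lebesgue_vec d \x^ Q)%E (touching n).
  apply: product_measure_unique => // A B mA mB.
  exact: product_measure2E.
pose C : R := 4 ^+ d.
have mX : measurable_fun (`[0%R, +oo[%classic : set (measurableTypeR R))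
    (fun r : R => (r ^+ d)%:E).
  apply/measurable_EFinP; apply: measurable_funTS.
  exact: measurable_funX.
have bound : (\int[Q]_(r in `[0%R, +oo[) (C%:E * ((n%:R ^+ d)%:E + (r ^+ d)%:E))
    < +oo)%E.
  rewrite ge0_integralZl//; last 3 first.
  - by apply: emeasurable_funD.
  - move=> r; rewrite /= in_itv/= andbT => r0.
    by rewrite adde_ge0// lee_fin exprn_ge0.
  - by rewrite lee_fin exprn_ge0.
  rewrite ge0_integralD//; last first.
    by move=> r; rewrite /= in_itv/= andbT => r0; rewrite lee_fin exprn_ge0.
  rewrite lte_mul_pinfty// ?lee_fin ?exprn_ge0//.
  rewrite lte_add_pinfty// integral_cst//.
  rewrite lte_mul_pinfty// ?lee_fin ?exprn_ge0//.
  by rewrite (le_lt_trans (probability_le1 _ _)) ?ltry.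
apply: le_lt_trans bound.
rewrite [leRHS]integral_mkcond.
rewrite /product_measure2/=.
apply: ge0_le_integral => //.
- exact: measurable_fun_ysection.
- apply/(measurable_restrictT _ _).1 => //.
  by apply: measurable_funeM; apply: emeasurable_funD.
move=> r _; rewrite patchE; case: ifPn; last first.
  rewrite notin_setE/= in_itv/= andbT => r0.
  rewrite (_ : ysection _ _ = set0) ?measure0//.
  apply/seteqP; split=> x//; rewrite /ysection/= inE => -[].
  by rewrite /halfspace/=.
rewrite inE/= in_itv/= andbT => r0.
have nr0 : 0 <= n%:R + r by rewrite addr_ge0.
apply: (@le_trans _ _ (lebesgue_vec d [set x : vec R d | vnorm x <= n%:R + r])).
  apply: le_measure; rewrite ?inE//.
  - exact: measurable_ysection.
  - rewrite -[X in measurable X]setTI; apply: measurable_fun_le => //.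
    exact: measurable_vnorm.
  - by move=> x; rewrite /ysection/= inE => -[].
apply: (le_trans (lebesgue_vec_cball0 nr0)).
rewrite -EFinD -EFinM lee_fin /C [leRHS]mulrDr -!exprMn.
have [nr|rn] := leP (n%:R : R) r.
  apply: (@le_trans _ _ ((4 * r) ^+ d)); last by rewrite lerDr exprn_ge0// mulr_ge0.
  by rewrite lerXn2r// ?nnegrE ?mulr_ge0//; lra.
apply: (@le_trans _ _ ((4 * n%:R) ^+ d)).
  by rewrite lerXn2r// ?nnegrE ?mulr_ge0//; lra.
by rewrite lerDl exprn_ge0// mulr_ge0.
Qed.

(** Continuity from above: these sets decrease to the empty set and have finite measure. *)
Lemma far_touching_cvg0 (a : R) (Q : probability (measurableTypeR R) R) n :
  (\int[Q]_(r in `[0%R, +oo[) ((r : R) ^+ d)%:E < +oo)%E ->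
  (intensity a Q (far_touching n m) @[m --> \oo] --> 0)%E.
Proof.
move=> /(touching_fin n) fin.
have mF := measurable_far_touching n.
rewrite -(mule0 a%:E); apply: cvgeZl => //.
have cap0 : \bigcap_m far_touching n m = set0.
  apply/seteqP; split=> X // h.
  have [X0 _] := (h 0%N Logic.I).1.
  have : (\bigcup_m cylinder m) X by rewrite bigcup_cylinder.
  by move=> [m _ mX]; have [] := h m Logic.I.
have <- : (lebesgue_vec d \x Q)%E (\bigcap_m far_touching n m) = 0%E.
  by rewrite cap0 measure0.
apply: nonincreasing_cvg_mu => //.
- apply: le_lt_trans fin; apply: le_measure; rewrite ?inE//.
    exact: measurable_touching.
  by move=> X [].
- by rewrite cap0.
- move=> p q pq; apply/subsetPset => X [tX nX]; split=> // pX.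
  exact: nX (cylinder_mono pq pX).
Qed.

(** With x the intensity of A, the void probability is exp(-x), and 1 - exp(-x) is at most x. *)
Lemma poisson_hits_le m (P : probability Omega R) A : is_poisson_process m P ->
  measurable A -> (0 <= m A)%E -> (m A < +oo)%E -> (P (hits A) <= m A)%E.
Proof.
move=> PP mA m0 mfin.
have PA0 : P (~` hits A) = poisson_prob (fine (m A)) 0 [set 0%N].
  have trivA : trivIset [set: 'I_1] (fun _ => A).
    by move=> i j _ _ _; rewrite !ord1.
  have := PP 1%N (fun _ => A) (fun _ => mA) (fun _ => mfin) trivA (fun _ => 0%N).
  rewrite big_ord1 => <-; congr (P _); rewrite hitsE; apply/seteqP.
  by split=> w /= => [/contrapT ->//|/(_ ord0) ->]; exact.
rewrite -(fineK (_ : m A \is a fin_num)) ?ge0_fin_numE//.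
have x0 : 0 <= fine (m A) by exact: fine_ge0.
move: (fine (m A)) x0 PA0 => x x0 PA0.
have mH := measurable_hits mA.
have PH : P (hits A) = (1 - P (~` hits A))%E.
  by rewrite -probability_setC ?setCK//; exact: measurableC.
rewrite PH PA0 /poisson_prob; case: ifPn => [xp|_].
  rewrite esum_set1 ?lee_fin ?poisson_pmf_ge0// /poisson_pmf xp expr0 fact0.
  rewrite invr1 !mul1r.
  by have := expR_ge1Dx (- x); lra.
(* In its other branch [poisson_prob] is the Dirac mass at 0, so A is almost surely void. *)
by rewrite diracE mem_set//= subee// lee_fin.
Qed.

(* When the process does not exist, poisson_law is the Dirac mass at the empty
   configuration, for which the bound is trivial. *)
Lemma poisson_law_hits_le (a : R) (Q : probability (measurableTypeR R) R)
    (A : set mpoint) :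
  measurable A -> (0 <= intensity a Q A)%E -> (intensity a Q A < +oo)%E ->
  (poisson_law a Q (hits A) <= intensity a Q A)%E.
Proof.
move=> mA m0 mfin; rewrite /poisson_law.
have [[P PP]|noP] := pselect
    (exists P : probability Omega R, is_poisson_process (intensity a Q) P).
  by apply: (poisson_hits_le _ mA m0 mfin); apply: getI PP.
rewrite getPN => [|P PP]; last by apply: noP; exists P.
by rewrite [leLHS]diracE memNset//= => -[].
Qed.

End poisson_bounds.

(** * Events in bounded windows determine the law *)

Section local_events.
Context {R : realType} {d : nat}.
Local Notation Omega := (config R d).
Local Notation mpoint := (mpoint R d).
Implicit Types (w : Omega) (A D : set mpoint).

Lemma config_eq w w' : points w = points w' -> w = w'.
Proof.
case: w w' => [W sW fW] [W' sW' fW'] /= WW'; subst W'.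
by congr Config; exact: Prop_irrelevance.
Qed.

Lemma restrict_restrict D D' w : D `<=` D' ->
  restrict D (restrict D' w) = restrict D w.
Proof.
move=> DD'; apply: config_eq; rewrite /= -setIA; congr (_ `&` _).
exact: setIidr.
Qed.

Lemma hits_restrict A D w : hits A (restrict D w) <-> hits (A `&` D) w.
Proof.
by split=> [[X [wX DX] AX]|[X wX [AX DX]]]; exists X.
Qed.

Lemma measurable_restrict_preimage D (E : set Omega) :
  measurable D -> measurable E -> measurable (restrict D @^-1` E).
Proof.
move=> mD mE; rewrite -[X in measurable X]setTI.
exact: (Pilot.Defs.measurable_restrict mD measurableT mE).
Qed.

Definition local_sets : set (set Omega) :=
  [set E | exists k (A : set Omega), measurable A /\
    E = restrict (cylinder k) @^-1` A].

Lemma local_setsI : setI_closed local_sets.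
Proof.
move=> _ _ [k [A [mA ->]]] [l [B [mB ->]]].
exists (maxn k l), (restrict (cylinder k) @^-1` A `&`
                    restrict (cylinder l) @^-1` B).
split; first by
  apply: measurableI; apply: measurable_restrict_preimage => //;
  exact: measurable_cylinder.
have kl := cylinder_mono (leq_maxl k l); have lk := cylinder_mono (leq_maxr k l).
by apply/seteqP; split=> w /=; rewrite !restrict_restrict.
Qed.

Lemma local_sets_measurable : local_sets `<=` measurable.
Proof.
move=> _ [k [A [mA ->]]].
by apply: measurable_restrict_preimage => //; exact: measurable_cylinder.
Qed.

(** The number of points in A is the limit of the numbers in its intersections with the cylinders,
    and each of these is a local variable. *)
Lemma measurable_local_sets (E : set Omega) :
  measurable E -> <<s local_sets >> E.
Proof.
apply: smallest_sub; first exact: smallest_sigma_algebra.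
move=> _ [A [B [mA mB ->]]].
have : measurable_fun setT (npoints A : g_sigma_algebraType local_sets -> \bar R).
  apply: (@emeasurable_fun_cvg _ (g_sigma_algebraType local_sets) R setT
    (fun k => npoints (A `&` cylinder k))) => [k|w _].
    move=> _ C mC; rewrite setTI; apply: sub_sigma_algebra.
    exists k, (npoints A @^-1` C); split.
      by rewrite -[X in measurable X]setTI; exact: measurable_npoints.
    apply/seteqP; split=> w /=;
      by rewrite /npoints/= -setIA (setIC (cylinder k)).
  have mAk k : measurable (A `&` cylinder k).
    by apply: measurableI => //; exact: measurable_cylinder.
  have AE : points w `&` \bigcup_k (A `&` cylinder k) = points w `&` A.
    rewrite -setI_bigcupr bigcup_cylinder.
    apply/seteqP; split=> X [wX]; first by case.
    by split=> //; split=> //; exact: points_sub wX.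
  rewrite [X in _ --> X](_ : _ = points_measure w (\bigcup_k (A `&` cylinder k))).
    rewrite (_ : (fun k => _) = points_measure w \o (fun k => A `&` cylinder k)).
      apply: nondecreasing_cvg_mu => //; first exact: bigcup_measurable.
      move=> k l kl; apply/subsetPset => X [AX kX]; split=> //.
      exact: cylinder_mono kX.
    by apply/funext => k /=; rewrite points_measureE.
  by rewrite points_measureE /npoints AE.
by move=> /(_ measurableT B mB); rewrite setTI.
Qed.

(** Local events form a generating family closed under intersection, so the uniqueness theorem for
    measures applies. *)
Lemma eq_probability_local (P1 P2 : probability Omega R) :
  (forall k (A : set Omega), measurable A ->
    P1 (restrict (cylinder k) @^-1` A) = P2 (restrict (cylinder k) @^-1` A)) ->
  forall E, measurable E -> P1 E = P2 E.
Proof.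
move=> P12 E mE.
apply: (@g_sigma_algebra_measure_unique _ R Omega local_sets
  local_sets_measurable (fun _ => setT) _ _ P1 P2).
- by move=> _; exists 0%N, setT; split=> //; rewrite preimage_setT.
- by apply/seteqP; split=> // w _; exists 0%N.
- exact: local_setsI.
- by move=> _ [k [A [mA ->]]]; exact: P12.
- by move=> k; exact: le_lt_trans (probability_le1 P1 measurableT) (ltry _).
- exact: measurable_local_sets.
Qed.

End local_events.

(** * Comparison of Gibbs kernels through the coupling, and uniqueness *)

Section gibbs.
Context {R : realType} {d : nat}.
Local Notation Omega := (config R d).
Local Notation mpoint := (mpoint R d).

Lemma ae_le_measure d0 (T : measurableType d0) (P : probability T R)
    (A B : set T) : measurable A -> measurable B ->
  {ae P, forall x, A x -> B x} -> (P A <= P B)%E.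
Proof.
move=> mA mB [N [mN PN0 sN]].
rewrite -[leRHS]adde0 -PN0; apply: le_trans (measureU2 _ mB mN).
apply: le_measure; rewrite ?inE//; first exact: measurableU.
move=> x Ax; have [Bx|nBx] := pselect (B x); first by left.
by right; apply: sN => /= /(_ Ax).
Qed.

Variables (H : set mpoint -> Omega -> Omega -> \bar R).
Variables (lambda : R) (Q : probability (measurableTypeR R) R).
Variables (a : R) (Qa : probability (measurableTypeR R) R).
Variable K : set mpoint -> Omega -> Omega ->
  probability (Omega * Omega * Omega)%type R.
Hypothesis coupling : disagreement_coupling H lambda Q a Qa K.

Local Notation gibbs := (gibbs_in H lambda Q).
Local Notation poi := (poisson_law a Qa : probability Omega R).

(** Deleting the points outside D can only destroy an increasing event. *)
Lemma poisson_in_le D (E : set Omega) : measurable D -> measurable E ->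
  (forall w w', points w `<=` points w' -> E w -> E w') ->
  (poisson_in D a Qa E <= poi E)%E.
Proof.
move=> mD mE incE; rewrite /poisson_in /pushforward.
apply: le_measure; rewrite ?inE//.
  exact: measurable_restrict_preimage.
by move=> w /=; apply: incE => X [].
Qed.

Lemma measurable_marginal1 (E : set Omega) : measurable E ->
  measurable [set x : Omega * Omega * Omega | E x.1.1].
Proof.
move=> mE; have : measurable_fun setT (fun x : Omega * Omega * Omega => x.1.1).
  exact: measurableT_comp measurable_fst measurable_fst.
by move=> /(_ measurableT E mE); rewrite setTI.
Qed.

Lemma measurable_marginal2 (E : set Omega) : measurable E ->
  measurable [set x : Omega * Omega * Omega | E x.1.2].
Proof.
move=> mE; have : measurable_fun setT (fun x : Omega * Omega * Omega => x.1.2).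
  exact: measurableT_comp measurable_snd measurable_fst.
by move=> /(_ measurableT E mE); rewrite setTI.
Qed.

Lemma measurable_marginal3 (E : set Omega) : measurable E ->
  measurable [set x : Omega * Omega * Omega | E x.2].
Proof.
move=> mE; have := @measurable_snd _ _ (Omega * Omega)%type Omega measurableT E mE.
by rewrite setTI.
Qed.

(** The coupling is used with both boundary conditions equal to g: its first component lies inside
    the Poisson component, and hitting A is an increasing event. *)
Lemma gibbs_in_hits_le D g A : Sbp D -> confined (~` D) g -> measurable A ->
  (gibbs D g (hits A) <= poi (hits A))%E.
Proof.
move=> SD gD mA; have [_ /(_ g g gD gD)[m1 _ m3 sub _]] := coupling SD.
have mH := measurable_hits mA.
have mD : measurable D by case: SD.
have incH w w' : points w `<=` points w' -> hits A w -> hits A w'.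
  by move=> ww' [X wX AX]; exists X => //; exact: ww'.
rewrite -m1//; apply: le_trans (poisson_in_le mD mH incH).
rewrite -m3//; apply: ae_le_measure.
- exact: measurable_marginal1.
- exact: measurable_marginal3.
move: sub; apply: filterS => x s [X wX AX].
by exists X => //; apply: s; left.
Qed.

(** Unless the Poisson component escapes from [cylinder k] beyond B(0, n), the two Gibbs components
    agree on that cylinder, because no boundary ball touches B(0, n). *)
Lemma gibbs_in_local_le k m n (A : set Omega) g1 g2
    (E := restrict (cylinder k) @^-1` A) :
  measurable A -> (k <= m)%N ->
  confined (~` cylinder m) g1 -> confined (~` cylinder m) g2 ->
  ~ hits (far_touching n m) g1 -> ~ hits (far_touching n m) g2 ->
  (gibbs (cylinder m) g1 E <=
   gibbs (cylinder m) g2 E + poi (escape (cylinder k) n))%E.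
Proof.
move=> mA km c1 c2 h1 h2.
have mE : measurable E.
  by apply: local_sets_measurable; exists k, A.
have SD := @Sbp_cylinder R d m.
have mF := measurable_escape n (@measurable_cylinder R d k).
have [_ /(_ g1 g2 c1 c2)[m1 m2 m3 sub conn]] := coupling SD.
apply: (@le_trans _ _ (gibbs (cylinder m) g2 E +
    poisson_in (cylinder m) a Qa (escape (cylinder k) n))%E); last first.
  rewrite leeD2l//; apply: poisson_in_le => //.
    exact: measurable_cylinder.
  exact: escape_mono.
rewrite -m1// -m2// -m3//.
have mE2 := measurable_marginal2 mE; have mF3 := measurable_marginal3 mF.
apply: le_trans (measureU2 _ mE2 mF3).
apply: ae_le_measure; first exact: measurable_marginal1.
  exact: measurableU.
move: sub conn; apply: filterS2 => x sub conn Ex.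
have [Fx|nFx] := pselect (escape (cylinder k) n x.2); first by right.
(* A disagreement X in the small cylinder is a Poisson point connected to a boundary point Y whose
   ball misses B(0, n), so [connected_escape] applies. *)
have esc X : (points x.1.1 `+` points x.1.2) X -> ~ cylinder k X.
  move=> X12 kX; apply: nFx; have [Y gY XY] := conn X X12.
  have wX : points x.2 X by apply: sub; case: X12 => -[]; [left|right].
  have [Y0 Yfar] : halfspace R d Y /\ ~ touching n Y.
    by case: gY => gY; (split; first exact: points_sub gY) => tY;
      [apply: h1|apply: h2]; exists Y => //; split=> //; [exact: c1|exact: c2].
  apply: (connected_escape wX kX Y0) XY.
  by rewrite ltNge; apply/negP => Yn; apply: Yfar.
left; rewrite /E/= (_ : restrict _ x.1.2 = restrict (cylinder k) x.1.1)//.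
apply: config_eq; apply/seteqP; split=> X /= [xX kX]; split=> //;
  apply: contrapT => nX; apply: (esc X) => //.
- by right.
- by left.
Qed.

Section gibbs_state.
Variable P : probability Omega R.
Hypothesis gP : gibbs_state H lambda Q P.

Lemma measurable_gibbs_in D E : Sbp D -> measurable E ->
  measurable_fun setT (fun t => gibbs D (restrict (~` D) t) E).
Proof. by move=> SD mE; have [] := gP SD mE. Qed.

Lemma gibbs_DLR D E : Sbp D -> measurable E ->
  P (restrict D @^-1` E) = (\int[P]_t gibbs D (restrict (~` D) t) E)%E.
Proof.
move=> SD mE; have [_ /(_ setT measurableT)] := gP SD mE.
by rewrite preimage_setT setIT.
Qed.

Lemma confined_restrict D t : confined D (restrict D t : Omega).
Proof. by move=> X []. Qed.

Lemma gibbs_in_ge0 D g E : Sbp D -> confined (~` D) g -> measurable E ->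
  (0 <= gibbs D g E)%E.
Proof.
by move=> SD gD mE; have [_ /(_ g g gD gD)[<-]] := coupling SD.
Qed.

(** In each cylinder the kernel bound is averaged by the DLR equations; the cylinders then increase
    to the whole space. *)
Lemma gibbs_state_hits_le A : measurable A -> (P (hits A) <= poi (hits A))%E.
Proof.
move=> mA.
have step m : (P (hits (A `&` cylinder m)) <= poi (hits A))%E.
  have -> : hits (A `&` cylinder m) = restrict (cylinder m) @^-1` hits A.
    by apply/seteqP; split=> w; [move/hits_restrict|move=> ?; exact/hits_restrict].
  have SD := @Sbp_cylinder R d m; have mH := measurable_hits mA.
  rewrite gibbs_DLR//.
  rewrite -[leRHS]mule1 -(@probability_setT _ _ _ P) -integral_cst//.
  apply: ge0_le_integral => //.
  - by move=> t _; apply: gibbs_in_ge0 => //; exact: confined_restrict.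
  - exact: measurable_gibbs_in.
  - by move=> t _; apply: gibbs_in_hits_le => //; exact: confined_restrict.
have mAm m : measurable (hits (A `&` cylinder m) : set Omega).
  by apply: measurable_hits; apply: measurableI => //; exact: measurable_cylinder.
have hA : hits A = \bigcup_m hits (A `&` cylinder m) :> set Omega.
  apply/seteqP; split=> [w [X wX AX]|w [m _ [X wX [AX _]]]]; last by exists X.
  have := points_sub wX; rewrite -bigcup_cylinder => -[m _ mX].
  by exists m => //; exists X.
have cvgP : (P \o (fun m => hits (A `&` cylinder m))) @ \oo -->
    P (\bigcup_m hits (A `&` cylinder m)).
  apply: nondecreasing_cvg_mu => //; first exact: bigcup_measurable.
  move=> m n mn; apply/subsetPset => w [X wX [AX mX]]; exists X => //.
  by split=> //; exact: cylinder_mono mX.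
rewrite {1}hA; apply: (cvge_to_le cvgP); apply: nearW => m; exact: step.
Qed.

Section comparison.
Variables (k m n : nat) (A : set Omega).
Hypotheses (mA : measurable A) (km : (k <= m)%N).
Let E : set Omega := restrict (cylinder k) @^-1` A.
Let c := gibbs (cylinder m) cfg0 E.
Let err := (poi (escape (cylinder k) n) + poi (hits (far_touching n m)))%E.

Let h t := gibbs (cylinder m) (restrict (~` cylinder m) t) E.
Let bad := hits (far_touching n m) : set Omega.
Let e := poi (escape (cylinder k) n).

Let mE : measurable E.
Proof. by apply: local_sets_measurable; exists k, A. Qed.

Let mbad : measurable bad.
Proof. apply: measurable_hits; exact: measurable_far_touching. Qed.

(** As k is at most m, restricting to [cylinder m] first does not affect E. *)
Let PE : P E = (\int[P]_t h t)%E.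
Proof.
rewrite -gibbs_DLR//; last exact: Sbp_cylinder.
congr (P _); apply/seteqP; split=> w; rewrite /E /= restrict_restrict//;
  exact: cylinder_mono.
Qed.

Let mh : measurable_fun setT h.
Proof. by apply: measurable_gibbs_in => //; exact: Sbp_cylinder. Qed.

Let h0 t : (0 <= h t)%E.
Proof.
apply: gibbs_in_ge0 => //; first exact: Sbp_cylinder.
exact: confined_restrict.
Qed.

Let c0 : (0 <= c)%E.
Proof. by apply: gibbs_in_ge0 => //; exact: Sbp_cylinder. Qed.

Let gibbs_in_le1 g : confined (~` cylinder m) g ->
  (gibbs (cylinder m) g E <= 1)%E.
Proof.
move=> cg; have [_ /(_ g g cg cg)[<-// _ _ _ _]] := coupling (@Sbp_cylinder R d m).
by apply: probability_le1; exact: measurable_marginal1.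
Qed.

Let ind t : \bar R := (\1_bad t)%:E.

Let mind : measurable_fun setT ind.
Proof. by apply/measurable_EFinP. Qed.

Let intD (f : Omega -> \bar R) (x : \bar R) : (0 <= x)%E ->
  (forall t, 0 <= f t)%E -> measurable_fun setT f ->
  (\int[P]_t (f t + (x + ind t)))%E = (\int[P]_t f t + (x + P bad))%E.
Proof.
move=> x0 f0 mf; have i0 t : (0 <= ind t)%E by rewrite lee_fin.
rewrite ge0_integralD//; last 2 first.
- by move=> t _; rewrite adde_ge0.
- exact: emeasurable_funD.
rewrite ge0_integralD// integral_cst// integral_indic// setIT.
by rewrite [X in (x * X)%E](_ : _ = 1%E) ?mule1//; exact: probability_setT.
Qed.

Let e_ge0 : (0 <= e)%E.
Proof. exact: measure_ge0. Qed.

(** On [bad] the indicator alone absorbs the difference, both kernels having values in [0, 1]. Off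
    [bad] neither t outside the cylinder nor the empty configuration has a far touching ball. *)
Let close t : (h t <= c + (e + ind t))%E /\ (c <= h t + (e + ind t))%E.
Proof.
have c1 : confined (~` cylinder m) (@cfg0 R d) by move=> X [].
have c2 := @confined_restrict (~` cylinder m) t.
have n1 : ~ hits (far_touching n m) (@cfg0 R d) by case.
rewrite /ind indicE; have [tb|tb] := boolP (t \in bad).
  have ge1 (x : \bar R) : (0 <= x -> 1 <= x + (e + 1%:E))%E.
    by move=> x0; rewrite addeA leeDr// adde_ge0.
  by split; apply: le_trans (ge1 _ _) => //; exact: gibbs_in_le1.
have n2 : ~ hits (far_touching n m) (restrict (~` cylinder m) t).
  move=> /hits_restrict [X wX [fX _]]; move: tb; rewrite notin_setE; apply.
  by exists X.
by rewrite adde0; split; exact: gibbs_in_local_le.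
Qed.

(** The pointwise bounds [close] are integrated over the boundary condition. Neither [c] nor [err]
    depends on P, which allows two Gibbs states to be compared. *)
Lemma gibbs_state_close : (P E <= c + err)%E /\ (c <= P E + err)%E.
Proof.
have Pbad : (P bad <= poi bad)%E.
  by apply: gibbs_state_hits_le; exact: measurable_far_touching.
have cE : c = (\int[P]_t cst c t)%E.
  rewrite integral_cst// [X in (c * X)%E](_ : _ = 1%E) ?mule1//.
  exact: probability_setT.
have i0 t : (0 <= ind t)%E by rewrite lee_fin.
rewrite PE; split.
  apply: (@le_trans _ _ (c + (e + P bad))%E); last first.
    by rewrite leeD2l// leeD2l.
  rewrite [in leRHS]cE -intD//; apply: ge0_le_integral => //.
    by apply: emeasurable_funD => //; exact: emeasurable_funD.
  by move=> t _; have [] := close t.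
apply: (@le_trans _ _ (\int[P]_t h t + (e + P bad))%E); last first.
  by rewrite leeD2l// leeD2l.
rewrite [leLHS]cE -intD//; apply: ge0_le_integral => //.
  by apply: emeasurable_funD => //; exact: emeasurable_funD.
by move=> t _; have [] := close t.
Qed.

End comparison.
End gibbs_state.

(** Both states are close to the same kernel with empty boundary condition. Each comparison costs
    two error terms, hence the tolerance eps / 4 for each. *)
Lemma gibbs_state_local_le (P1 P2 : probability Omega R) k (A : set Omega) :
  gibbs_state H lambda Q P1 -> gibbs_state H lambda Q P2 ->
  {ae poi, forall w, ~ percolates w} ->
  (\int[Qa]_(r in `[0%R, +oo[) ((r : R) ^+ d)%:E < +oo)%E -> 0 <= a ->
  measurable A ->
  (P1 (restrict (cylinder k) @^-1` A) <= P2 (restrict (cylinder k) @^-1` A))%E.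
Proof.
move=> g1 g2 np Qd a0 mA; set E := _ @^-1` A.
apply/lee_addgt0Pr => eps eps0.
have small (u : nat -> \bar R) : u @ \oo --> 0%E ->
    \forall i \near \oo, (u i < (eps / 4)%:E)%E.
  have e4 : (0 < (eps / 4)%:E)%E by rewrite lte_fin divr_gt0.
  by move=> u0; exact: (u0 _ (open_ereal_lt' e4)).
have [n /ltW en] : exists n, (poi (escape (cylinder k) n) < (eps / 4)%:E)%E.
  have [N _ hN] := small _ (escape_cvg0 k np).
  by exists N; exact: (hN N (leqnn N)).
(* The window m is chosen after n, as it must hold the centres of most balls touching B(0, n). *)
have [m km fm] : exists2 m, (k <= m)%N &
    (intensity a Qa (far_touching n m : set mpoint) < (eps / 4)%:E)%E.
  have [N _ hN] := small _ (far_touching_cvg0 a n Qd).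
  by exists (maxn k N); [exact: leq_maxl|exact: (hN _ (leq_maxr k N))].
have far : (poi (hits (far_touching n m)) <= (eps / 4)%:E)%E.
  apply: le_trans (ltW fm); apply: poisson_law_hits_le.
  - exact: measurable_far_touching.
  - by rewrite mule_ge0// lee_fin.
  - rewrite /intensity lte_mul_pinfty ?lee_fin//.
    apply: le_lt_trans (touching_fin n Qd).
    apply: le_measure; rewrite ?inE; last by move=> X [].
      exact: measurable_far_touching.
    exact: measurable_touching.
have [h1 _] := gibbs_state_close g1 n mA km.
have [_ h2] := gibbs_state_close g2 n mA km.
have err : (poi (escape (cylinder k) n) + poi (hits (far_touching n m)) <=
    (eps / 2)%:E)%E.
  by apply: (le_trans (leeD en far)); rewrite -EFinD lee_fin; lra.
apply: (le_trans h1); apply: (le_trans (leeD2r _ h2)); rewrite -addeA.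
by rewrite leeD2l//; apply: (le_trans (leeD err err)); rewrite -EFinD lee_fin; lra.
Qed.

End gibbs.

Theorem theorem3p3 (R : realType) (d : nat) (d_gt0 : (0 < d)%N)
    (lambda : R) (lambda_gt0 : 0 < lambda)
    (Q : probability (measurableTypeR R) R)
    (Q_nneg : Q `[0%R, +oo[%classic = 1%E)
    (H : set (mpoint R d) ->
         config R d -> config R d -> \bar R)
    (H_ham : hamiltonian H)
    (Z_fin : forall D g, Sbp D -> confined (~` D) g ->
       (partition_function H lambda Q D g < +oo)%E)
    (G_neq0 : exists P : probability (config R d) R, gibbs_state H lambda Q P)
    (alpha' : R) (alpha'_gt0 : 0 < alpha')
    (Q' : probability (measurableTypeR R) R)
    (Q'_nneg : Q' `[0%R, +oo[%classic = 1%E)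
    (Q'_moment : (\int[Q']_(r in `[0%R, +oo[) ((r : R) ^+ d)%:E < +oo)%E)
    (alpha'_sub : (alpha'%:E < alpha_c d Q')%E)
    (coupling : exists P, disagreement_coupling H lambda Q alpha' Q' P) :
  exists2 P : probability (config R d) R, gibbs_state H lambda Q P &
    forall P' : probability (config R d) R, gibbs_state H lambda Q P' ->
      forall E, measurable E -> P' E = P E.
Proof.
have [P gP] := G_neq0; have [K cK] := coupling.
have np : {ae (poisson_law alpha' Q' : probability (config R d) R),
    forall w, ~ percolates w}.
  (* An intensity below the supremum lies below some admissible t, which excludes percolation at
     that intensity. *)
  have [t [t0 ht] at_] := ereal_sup_gt alpha'_sub.
  by apply: ht => //; exact: ltW.
exists P => // P' gP'; apply: eq_probability_local => k A mA.
have a0 := ltW alpha'_gt0.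
apply/le_anti/andP; split.
  exact: (gibbs_state_local_le cK k gP' gP np Q'_moment a0 mA).
exact: (gibbs_state_local_le cK k gP gP' np Q'_moment a0 mA).
Qed.
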